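(* For any finite trees $T$ and $T'$, ${\rm dmg}(T\square T')={\rm rad}(T\square T')-1$.
   Context: ${\rm rad}$ denotes the radius of a graph. The Cartesian product $G\square H$ has vertex set $V(G)\times V(H)$, with $(u,v)\sim(u',v')$ iff ($u=u'$ and $vv'\in E(H)$) or ($v=v'$ and $uu'\in E(G)$). Damage game on a graph: one cop and one robber; in round $0$ the cop chooses a vertex, then the robber does; in each later round the cop moves to an adjacent vertex or passes, then the robber moves to an adjacent vertex or passes; the robber is captured if the cop occupies the robber's vertex. A vertex $v$ is damaged if the robber occupies $v$ in some round $i\ge0$ and in round $i+1$ the uncaptured robber passes or moves to a neighbour. The damage number ${\rm dmg}(\cdot)$ is the number of distinct vertices damaged when the cop plays to minimize and the robber to maximize this number.
   Formalization: When both trees are a single vertex, the damage number is 0 while rad − 1 = −1, so the formula fails; the formal statement reads rad − 1 as max(rad − 1, 0), which changes only this case. *)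

(* Defs.v *)
From mathcomp Require Import all_boot.
From mathcomp Require Import boolp.

Set Implicit Arguments.
Unset Strict Implicit.
Unset Printing Implicit Defensive.

(* A finite simple graph is a finType of vertices together with a symmetric
   irreflexive adjacency relation. *)

(* The least k < n satisfying P, and n if there is none. *)
Definition least (n : nat) (P : pred nat) : nat := find P (iota 0 n).

Section Graphs.

Variables (V : finType) (e : rel V).

(* Simple cycles have length at least 3; for symmetric e, every edge x y
   yields the ucycle [:: x; y]. *)
Definition acyclic : Prop := forall c : seq V, ucycle e c -> size c <= 2.

Definition is_tree : Prop :=
  [/\ symmetric e, irreflexive e, 0 < #|V|,
      (forall x y, connect e x y) & acyclic].

Definition walk_of_length (x y : V) (n : nat) : bool :=
  [exists p : n.-tuple V, path e x p && (last x p == y)].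

(* In a connected graph all distances and eccentricities are smaller than
   #|V|, so the default value #|V| below is never attained. *)
Definition dist (x y : V) : nat := least #|V| (walk_of_length x y).

Definition eccentricity (x : V) : nat := \max_(y : V) dist x y.

Definition rad : nat := \big[minn/#|V|]_(x : V) eccentricity x.

End Graphs.

Definition cartesian (V V' : finType) (e : rel V) (e' : rel V')
    : rel (V * V')%type :=
  fun p q => ((p.1 == q.1) && e' p.2 q.2) || ((p.2 == q.2) && e p.1 q.1).

Section DamageGame.

Variables (V : finType) (e : rel V).

Definition step (x y : V) : bool := (x == y) || e x y.

(* A cop strategy maps the sequence of the robber's positions in the rounds
   0, ..., i-1 to the cop's position in round i; its value at [::] is the
   cop's initial vertex.  The cop's own earlier positions are determined by
   the prefixes of this sequence. *)
Definition cop_strategy (s : seq V -> V) : Prop :=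
  forall h x, step (s h) (s (rcons h x)).

(* Positions after a capture are irrelevant: see damaged. *)
Definition robber_play (r : nat -> V) : Prop :=
  forall i, step (r i) (r i.+1).

Definition cop_play (s : seq V -> V) (r : nat -> V) (i : nat) : V :=
  s (mkseq r i).

(* The robber is still free after the cop's move of round i.+1: no capture
   by a robber's move onto the cop (c j = r j) nor by a cop's move onto the
   robber (c j.+1 = r j) has taken place. *)
Definition uncaptured (c r : nat -> V) (i : nat) : Prop :=
  forall j, j <= i -> c j <> r j /\ c j.+1 <> r j.

Definition damaged (c r : nat -> V) (v : V) : Prop :=
  exists i, r i = v /\ uncaptured c r i.

Definition damage (c r : nat -> V) : nat := #|[set v | `[< damaged c r v >]]|.

Definition cop_can_limit (k : nat) : Prop :=
  exists2 s, cop_strategy s &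
    forall r, robber_play r -> damage (cop_play s r) r <= k.

(* Minimum over the cop's strategies of the maximum damage over the robber's
   plays against it.  The damage is at most #|V|, hence the default value. *)
Definition dmg : nat := least #|V| (fun k => `[< cop_can_limit k >]).

End DamageGame.

(* Main.v *)
Require Import Defs.
From mathcomp Require Import all_boot.
From mathcomp Require Import boolp zify.

(* Lower bound, for any connected graph: the robber runs away from distance 2
   along a geodesic from the cop's initial vertex to a farthest one; in round i
   the robber is at distance i + 2 from the cop's initial vertex, out of reach.

   Upper bound: the cop starts at a center (z, z') and always decreases the
   larger of the two coordinate distances to the robber, passing when they are
   equal. As long as the distances differ, the cop moves in one coordinate only
   and stays at the center of the other; once equal after a cop move, they
   remain so after every later one. Hence in each coordinate the cop stays on
   the geodesic from the center to the robber, so the number of his moves is at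
   most rad T + rad T' minus the two remaining distances. Each cop move pays for
   the vertex just damaged; at most one further vertex is damaged for free, when
   the distances first become equal, and then both remain positive. *)

Set Implicit Arguments.
Unset Strict Implicit.
Unset Printing Implicit Defensive.

(** * Bounded minimization *)

Lemma least_le n (P : pred nat) k : P k -> least n P <= k.
Proof.
move=> Pk; rewrite /least leqNgt; apply/negP => k_lt.
have k_n : k < n by rewrite -(size_iota 0 n) (leq_trans k_lt) ?find_size.
by move: (before_find 0 k_lt); rewrite nth_iota // add0n Pk.
Qed.

Lemma least_holds n (P : pred nat) k : k < n -> P k -> P (least n P).
Proof.
move=> k_n Pk.
have hasP : has P (iota 0 n) by apply/hasP; exists k; rewrite // mem_iota.
have := nth_find 0 hasP; rewrite nth_iota //.
by rewrite -[n in _ < n](size_iota 0) -has_find.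
Qed.

(** * Distance, eccentricity and radius in connected graphs; the lower bound *)

Section Distance.

Variables (V : finType) (e : rel V).

Lemma walkP x y n :
  reflect (exists p, [/\ size p = n, path e x p & last x p = y])
          (walk_of_length e x y n).
Proof.
apply: (iffP existsP) => [[p /andP[ep /eqP lp]]|[p [sp ep lp]]].
  by exists p; rewrite size_tuple.
by exists (tcast sp (in_tuple p)); rewrite val_tcast ep lp eqxx.
Qed.

Lemma dist_le x y n : walk_of_length e x y n -> dist e x y <= n.
Proof. exact: least_le. Qed.

Lemma dist_xx x : dist e x x = 0.
Proof. by apply/eqP; rewrite -leqn0; apply/dist_le/walkP; exists [::]. Qed.

Lemma rad_le x : rad e <= eccentricity e x.
Proof.
rewrite /rad; have: x \in index_enum V by rewrite mem_index_enum.
elim: (index_enum V) => // y s IHs; rewrite inE big_cons.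
by case/orP=> [/eqP <-|/IHs]; rewrite geq_min ?leqnn // => ->; rewrite orbT.
Qed.

Hypothesis conn : forall x y, connect e x y.

Lemma dist_walk x y : walk_of_length e x y (dist e x y).
Proof.
have /connectP[p ep ->] := conn x y.
have [q eq uq _] := shortenP ep.
(* [least] searches only below [#|V|], so the walk must first be made duplicate-free. *)
apply: (@least_holds _ _ (size q)); last by apply/walkP; exists q.
by rewrite -[(size q).+1]/(size (x :: q)) -(card_uniqP uq) max_card.
Qed.

Lemma dist_eq0 x y : dist e x y = 0 -> x = y.
Proof. by move=> d0; have /walkP[[|? ?] []] := dist_walk x y; rewrite d0. Qed.

Lemma dist_triangle y x z : dist e x z <= dist e x y + dist e y z.
Proof.
have /walkP[p [<- ep lp]] := dist_walk x y.
have /walkP[q [<- eq <-]] := dist_walk y z.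
apply/dist_le/walkP; exists (p ++ q).
by rewrite size_cat cat_path last_cat lp ep eq.
Qed.

Lemma dist_edge x y : e x y -> dist e x y <= 1.
Proof. by move=> exy; apply/dist_le/walkP; exists [:: y]; rewrite /= exy. Qed.

Lemma dist_edger z x y : e x y -> dist e z y <= (dist e z x).+1.
Proof.
by move=> /dist_edge exy; rewrite -addn1 (leq_trans (dist_triangle x z y)) ?leq_add2l.
Qed.

Lemma dist_stepr z x y : step e x y -> dist e z y <= (dist e z x).+1.
Proof. by case/orP=> [/eqP->|/dist_edger->]. Qed.

Lemma dist_prev x y n :
  dist e x y = n.+1 -> exists2 w, e w y & dist e x w = n.
Proof.
move=> dxy; have /walkP[p] := dist_walk x y; rewrite dxy.
case/lastP: p => [[]//|q w]; rewrite size_rcons last_rcons rcons_path.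
case=> [[sq] /andP[eq ew] wy]; subst w; exists (last x q) => //.
apply/eqP; rewrite eqn_leq; apply/andP; split.
  by rewrite -sq; apply/dist_le/walkP; exists q.
by rewrite -ltnS -dxy; exact: dist_edger.
Qed.

(** The geodesic is extended to all times by resting at [y], so that a shift of it is a legal
    infinite play of the robber. *)
Lemma dist_geodesic x y : exists g : nat -> V,
  [/\ forall i, step e (g i) (g i.+1), g (dist e x y) = y
    & forall i, i <= dist e x y -> dist e x (g i) = i].
Proof.
move nE: (dist e x y) => n; elim: n y nE => [|n IHn] y dxy.
  exists (fun=> y); split=> // i; first by rewrite /step eqxx.
  by rewrite leqn0 => /eqP->.
have [w ewy /IHn[g [g_step g_last g_dist]]] := dist_prev dxy.
exists (fun i => if i <= n then g i else y); split=> [i||i]; last first.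
- rewrite leq_eqVlt ltnS => /orP[/eqP->|le_in]; first by rewrite ltnn.
  by rewrite le_in g_dist.
- by rewrite ltnn.
case: (ltngtP i n) => // [_|->]; first by rewrite /step eqxx.
by rewrite g_last /step ewy orbT.
Qed.

Lemma dist_le_eccentricity x y : dist e x y <= eccentricity e x.
Proof. exact: (leq_bigmax y). Qed.

Lemma eccentricity_le_card x : eccentricity e x <= #|V|.
Proof.
by apply/bigmax_leqP => y _; rewrite -[leqRHS](size_iota 0); exact: find_size.
Qed.

Lemma eccentricity_attained x : exists y, dist e x y = eccentricity e x.
Proof.
have V_gt0 : 0 < #|V| by apply/card_gt0P; exists x.
by have [y ecc_y] := eq_bigmax (dist e x) V_gt0; exists y.
Qed.

Lemma center_exists (x0 : V) : exists z, eccentricity e z = rad e.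
Proof.
case: (arg_minnP (eccentricity e) (isT : predT x0)) => z _ z_min.
exists z; apply/eqP; rewrite eqn_leq rad_le andbT.
(* The default [#|V|] of the minimum does no harm, as it bounds every eccentricity. *)
rewrite /rad; elim/big_ind: _ => [|m n|y _]; last exact: z_min.
  exact: eccentricity_le_card.
by rewrite leq_min => -> ->.
Qed.

Lemma cop_can_limit_ge k : cop_can_limit e k -> rad e - 1 <= k.
Proof.
case=> s s_strat s_limit; set c0 := s [::].
have [y dy] := eccentricity_attained c0.
have le_rad := rad_le c0.
have [g [g_step _]] := dist_geodesic c0 y; rewrite dy => g_dist.
pose r i := g i.+2.
apply: leq_trans (s_limit r (fun i => g_step i.+2)).
have cop_dist i : dist e c0 (cop_play s r i) <= i.
  elim: i => [|i IHi]; first by rewrite /cop_play dist_xx.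
  have: step e (cop_play s r i) (cop_play s r i.+1) by rewrite /cop_play mkseqS.
  by move=> /(dist_stepr c0) le_i; rewrite (leq_trans le_i).
(* These are the rounds with [i.+2 <= rad e]: the robber is then still on the geodesic, whose length
   is at least [rad e]. *)
pose f (i : 'I_(rad e - 1)) := r i.
have f_dist (i : 'I_(rad e - 1)) j : j <= i -> dist e c0 (r j) = j.+2.
  by move=> le_ji; apply: g_dist; have := ltn_ord i; lia.
have f_inj : injective f.
  move=> i j /(congr1 (dist e c0)); rewrite !(f_dist _ _ (leqnn _)).
  by case=> /val_inj.
rewrite -[leqLHS]card_ord -(card_imset predT f_inj); apply: subset_leq_card.
apply/subsetP=> _ /imsetP[i _ ->]; rewrite inE; apply/asboolP.
exists i; split=> // j /f_dist dj.
by split=> cj; move: dj; rewrite -cj;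
  [have := cop_dist j | have := cop_dist j.+1]; lia.
Qed.

End Distance.

Lemma step_edge (V : finType) (e : rel V) x y : e x y -> step e x y.
Proof. by rewrite /step orbC => ->. Qed.

(** * Geodesics and betweenness in trees *)

Section Tree.

Variables (V : finType) (e : rel V).
Hypothesis tree_e : is_tree e.

Let e_sym : symmetric e. Proof. by case: tree_e. Qed.
Let e_irr : irreflexive e. Proof. by case: tree_e. Qed.
Let conn x y : connect e x y. Proof. by case: tree_e. Qed.
Let e_acyc : acyclic e. Proof. by case: tree_e. Qed.

Local Notation d := (dist e).

Lemma dist_sym x y : d x y = d y x.
Proof.
suff le_d a b : d a b <= d b a by apply/eqP; rewrite eqn_leq !le_d.
move nE: (d b a) => n; elim: n a nE => [|n IHn] a dba.
  by rewrite (dist_eq0 conn dba) dist_xx.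
have [w ewa dbw] := dist_prev conn dba.
rewrite (leq_trans (dist_triangle conn w _ _)) // -add1n leq_add ?IHn //.
by rewrite dist_edge // e_sym.
Qed.

(* A detour from x to y would close up with the edge y x into a cycle. *)
Lemma tree_no_detour (f : rel V) x y :
  e x y -> subrel f e -> connect f x y -> f x y.
Proof.
move=> exy sub_fe /connectP[p0 fp0 y_last].
case: (shortenP fp0) y_last => p fp uniq_p _ y_last.
have: ucycle e (x :: p).
  by rewrite /ucycle uniq_p /= rcons_path (sub_path sub_fe fp) -y_last e_sym exy.
move/e_acyc; case: p fp uniq_p y_last => [|a [|//]] /=.
  by move=> _ _ yx; rewrite yx e_irr in exy.
by rewrite andbT => fxa _ ->.
Qed.

(** A geodesic back to [c] only descends and stays within level [n]; the bound serves to keep it off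
    a deleted arc. *)
Lemma connect_downward (f : rel V) c n :
  (forall a b, e a b -> d c a = (d c b).+1 -> d c a <= n -> f a b) ->
  forall v, d c v <= n -> connect f v c.
Proof.
move=> f_down v; move mE: (d c v) => m.
elim: m v mE => [|m IHm] v dv le_mn; first by rewrite (dist_eq0 conn dv).
have [w ewv dw] := dist_prev conn dv.
apply: connect_trans (IHm _ dw (ltnW le_mn)); apply: connect1.
by apply: f_down; rewrite ?dw ?dv // e_sym.
Qed.

Lemma connect_upward (f : rel V) c :
  (forall a b, e a b -> d c b = (d c a).+1 -> f a b) ->
  forall v, connect f c v.
Proof.
move=> f_up v; move mE: (d c v) => m.
elim: m v mE => [|m IHm] v dv; first by rewrite (dist_eq0 conn dv).
have [w ewv dw] := dist_prev conn dv.
by apply: connect_trans (IHm _ dw) _; apply/connect1/f_up; rewrite ?dv ?dw.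
Qed.

Definition remove_arc x y : rel V := fun a b => e a b && ~~ ((a == x) && (b == y)).

(** Every edge of a tree is a bridge. *)
Lemma tree_remove_arc x y : e x y -> ~~ connect (remove_arc x y) x y.
Proof.
move=> exy; apply/negP => /(tree_no_detour exy).
rewrite /remove_arc !eqxx andbF => H; suff: false by [].
by apply: H => a b /andP[].
Qed.

(** At equal distances, descending from [x] to [c] and climbing to [y] would bypass the bridge,
    since each arc used changes the distance to [c]. *)
Lemma tree_dist_edge_neq c x y : e x y -> d c x != d c y.
Proof.
move=> exy; apply/negP => /eqP dxy; case/negP: (tree_remove_arc exy).
apply: (@connect_trans _ _ c).
  apply: (@connect_downward _ c (d c x)) => // a b eab dab _.
  by rewrite /remove_arc eab; apply/negP => /andP[/eqP ax /eqP bY]; subst; lia.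
apply: connect_upward => a b eab dab.
by rewrite /remove_arc eab; apply/negP => /andP[/eqP ax /eqP bY]; subst; lia.
Qed.

Lemma tree_dist_edge c x y : e x y -> d c x = (d c y).+1 \/ d c y = (d c x).+1.
Proof.
move=> exy; have := tree_dist_edge_neq c exy.
have := dist_edger conn c exy; rewrite e_sym in exy.
by have := dist_edger conn c exy; lia.
Qed.

(** Otherwise the route from [u] by [w] down to [c] and up to [v] would bypass the bridge: below [w]
    the levels are too low for the arc from [u] to [v], and the climb never descends. *)
Lemma tree_prev_uniq c u v w :
    e u v -> e u w -> d c u = (d c v).+1 -> d c u = (d c w).+1 -> v = w.
Proof.
move=> euv euw duv duw; apply/eqP/negPn/negP => /eqP neq_vw.
case/negP: (tree_remove_arc euv).
apply: (@connect_trans _ _ w).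
  apply: connect1; rewrite /remove_arc euw eqxx /=.
  by apply/negP => /eqP wv; case: neq_vw.
apply: (@connect_trans _ _ c).
  apply: (@connect_downward _ c (d c w)) => // a b eab dab le_aw.
  by rewrite /remove_arc eab; apply/negP => /andP[/eqP ax /eqP bY]; subst; lia.
apply: connect_upward => a b eab dab.
by rewrite /remove_arc eab; apply/negP => /andP[/eqP ax /eqP bY]; subst; lia.
Qed.

Definition between z c u : Prop := d z c + d c u = d z u.

Lemma between_refl z u : between z z u.
Proof. by rewrite /between dist_xx. Qed.

(** The side condition excludes a robber at [c] who steps back towards [z]. *)
Lemma between_step z c u v :
  between z c u -> step e u v -> 0 < d c u \/ c = z -> between z c v.
Proof.
move=> zcu /orP[/eqP<- //|euv] [cu|->]; last exact: between_refl.
rewrite /between in zcu *; have tri := dist_triangle conn c z v.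
have [dcv|dcv] := tree_dist_edge c euv; first by have := tree_dist_edge z euv; lia.
have [dzv|] := tree_dist_edge z euv; last by lia.
(* Now [v] is nearer to [z] but farther from [c] than [u]. The neighbour [w] of [u] towards [c] is
   also nearer to [z], so uniqueness forces [v = w], a contradiction. *)
have [w ewu dw] : exists2 w, e w u & d c w = (d c u).-1.
  by apply: dist_prev => //; rewrite prednK.
have dzw := dist_triangle conn c z w.
have euw : e u w by rewrite e_sym.
have := tree_dist_edge z euw => dzw'.
have vw : v = w by apply: (tree_prev_uniq (c := z) euv euw); lia.
by subst v; lia.
Qed.

(** The default [c] makes this a legal move, a pass, when no neighbour is closer. *)
Definition toward c u := odflt c [pick w | e c w && (d w u < d c u)].

Lemma toward_step c u : step e c (toward c u).
Proof.
rewrite /step /toward; case: pickP => [w /andP[-> _]|_] /=; first by rewrite orbT.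
by rewrite eqxx.
Qed.

Lemma toward_dist c u : 0 < d c u -> d c u = (d (toward c u) u).+1.
Proof.
move=> cu; have duc : d u c = (d u c).-1.+1 by rewrite dist_sym prednK.
have [w ewc dw] := dist_prev conn duc.
rewrite /toward; case: pickP => [x /andP[ecx lt_x]|/(_ w)] /=.
  by have := tree_dist_edge u ecx; rewrite !(dist_sym u); lia.
by rewrite e_sym ewc (dist_sym w) dw (dist_sym u); lia.
Qed.

Lemma toward_between z c u : between z c u -> 0 < d c u ->
  between z (toward c u) u /\ d z (toward c u) = (d z c).+1.
Proof.
rewrite /between => zcu /toward_dist dt.
have := dist_stepr conn z (toward_step c u).
by have := dist_triangle conn (toward c u) z u; lia.
Qed.

End Tree.

(** * The product of two trees and the chase invariants *)

Section Product.

Variables (T T' : finType) (e : rel T) (e' : rel T').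
Hypotheses (tree_e : is_tree e) (tree_e' : is_tree e').

Let conn x y : connect e x y. Proof. by case: tree_e. Qed.
Let conn' x y : connect e' x y. Proof. by case: tree_e'. Qed.

Local Notation E := (cartesian e e').
Local Notation d := (dist e).
Local Notation d' := (dist e').

Lemma connect_cartesian p q : connect E p q.
Proof.
case: p q => [x x'] [y y']; apply: (@connect_trans _ _ (y, x')).
  have /connectP[p ep ->] := conn x y.
  elim: p x ep => //= z p IHp x /andP[exz /IHp]; apply: connect_trans.
  by apply: connect1; rewrite /cartesian /= eqxx exz orbT.
have /connectP[p ep ->] := conn' x' y'.
elim: p x' ep => //= z p IHp x' /andP[exz /IHp]; apply: connect_trans.
by apply: connect1; rewrite /cartesian /= eqxx exz.
Qed.

(** An edge of the product is an edge in just one coordinate, so it raises the sum by at most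
    one. *)
Lemma dist_cartesian_ge p q : d p.1 q.1 + d' p.2 q.2 <= dist E p q.
Proof.
move nE: (dist E p q) => n; elim: n q nE => [|n IHn] q dpq.
  by rewrite (dist_eq0 connect_cartesian dpq) !dist_xx.
have [w ewq /IHn] := dist_prev connect_cartesian dpq.
case/orP: ewq => /andP[/eqP<-].
  by move=> /(dist_edger conn' p.2); lia.
by move=> /(dist_edger conn p.1); lia.
Qed.

Lemma rad_cartesian_ge (x : T) (x' : T') : rad e + rad e' <= rad E.
Proof.
have [[z z'] <-] := center_exists E (x, x').
have [y dy] := eccentricity_attained e z; have [y' dy'] := eccentricity_attained e' z'.
apply: leq_trans (dist_le_eccentricity E _ (y, y')).
apply: leq_trans (dist_cartesian_ge _ _).
by rewrite leq_add // ?dy ?dy' rad_le.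
Qed.

Definition chase (c u : T * T') : T * T' :=
  if d' c.2 u.2 < d c.1 u.1 then (toward e c.1 u.1, c.2)
  else if d c.1 u.1 < d' c.2 u.2 then (c.1, toward e' c.2 u.2)
  else c.

Lemma chase_step c u : step E c (chase c u).
Proof.
rewrite /chase /step /cartesian; case: c => c c'.
case: ifP => _ /=; last case: ifP => _ /=; last by rewrite eqxx.
  by rewrite xpair_eqE !eqxx andbT; case/orP: (toward_step e c u.1) => ->; rewrite ?orbT.
by rewrite xpair_eqE !eqxx; case/orP: (toward_step e' c' u.2) => ->; rewrite ?orbT.
Qed.

Variables (z : T) (z' : T').

(* [n] is to bound the number of vertices visited by the robber; by betweenness,
   [d z c.1 + d' z' c.2] counts the moves of the cop. *)
Definition after_robber (n : nat) (c u : T * T') : Prop :=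
  [/\ between e z c.1 u.1, between e' z' c.2 u.2,
      (d' c.2 u.2).+1 < d c.1 u.1 -> c.2 = z',
      (d c.1 u.1).+1 < d' c.2 u.2 -> c.1 = z
    & n <= d z c.1 + d' z' c.2 + 1 +
           ((d c.1 u.1 == (d' c.2 u.2).+1) || (d' c.2 u.2 == (d c.1 u.1).+1))].

(** The last term is the one free vertex. A robber's step changes the difference of the distances by
    at most one, whence the shifted inequalities in [after_robber]. *)
Definition after_cop (n : nat) (c u : T * T') : Prop :=
  [/\ between e z c.1 u.1, between e' z' c.2 u.2,
      d' c.2 u.2 < d c.1 u.1 -> c.2 = z',
      d c.1 u.1 < d' c.2 u.2 -> c.1 = z
    & n <= d z c.1 + d' z' c.2 + (d c.1 u.1 == d' c.2 u.2)].

(** If the distances differ, the cop's move absorbs the [+ 1], and they become equal exactly when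
    they differed by one. If they are equal, he passes and the [+ 1] becomes the equality term. *)
Lemma after_chase n c u : after_robber n c u -> after_cop n (chase c u) u.
Proof.
case=> B B' far far' le_n; rewrite /chase.
case: (ltngtP (d' c.2 u.2) (d c.1 u.1)) => cmp /=.
- have pos : 0 < d c.1 u.1 by lia.
  have [Bt dt] := toward_between tree_e B pos; have dtu := toward_dist tree_e pos.
  by split=> //=; [move=> ?; apply: far; lia | lia | lia].
- have pos : 0 < d' c.2 u.2 by lia.
  have [Bt dt] := toward_between tree_e' B' pos; have dtu := toward_dist tree_e' pos.
  by split=> //=; [lia | move=> ?; apply: far'; lia | lia].
by split=> //; lia.
Qed.

Lemma pair_dist_gt0 (c u : T * T') : c <> u -> 0 < d c.1 u.1 + d' c.2 u.2.
Proof.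
case: c u => [c c'] [u u'] neq_cu; rewrite lt0n addn_eq0; apply/negP.
move=> /andP[/eqP/(dist_eq0 conn)/= eq_cu /eqP/(dist_eq0 conn')/= eq_cu'].
by case: neq_cu; rewrite eq_cu eq_cu'.
Qed.

(** A new vertex is paid for by the [+ 1]; when a step breaks equality, the equality term turns into
    the term for a difference of one. *)
Lemma after_flight n c u v : after_cop n c u -> c <> u -> step E u v ->
  after_robber (n + (u != v)) c v.
Proof.
case=> B B' far far' le_n neq_cu uv.
have pos := pair_dist_gt0 neq_cu.
(* A zero distance in one coordinate leaves the other positive, so the cop is still at the center of
   the first. *)
have side : 0 < d c.1 u.1 \/ c.1 = z.
  by case: (posnP (d c.1 u.1)) => [d0|]; [right; apply: far' | left]; lia.
have side' : 0 < d' c.2 u.2 \/ c.2 = z'.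
  by case: (posnP (d' c.2 u.2)) => [d0|]; [right; apply: far | left]; lia.
have stepP : [\/ u = v, e u.1 v.1 /\ u.2 = v.2 | u.1 = v.1 /\ e' u.2 v.2].
  case/orP: uv => [/eqP->|]; first by constructor 1.
  case/orP=> /andP[/eqP eq_uv e_uv]; first by constructor 3.
  by constructor 2.
case: stepP {uv} => [<-|[e_uv eq_uv]|[eq_uv e_uv]].
- by rewrite eqxx; split=> //; [move=> ?; apply: far | move=> ?; apply: far' |]; lia.
- have dv := tree_dist_edge tree_e c.1 e_uv; have le1 := leq_b1 (u != v).
  have Bv := between_step tree_e B (step_edge e_uv) side.
  by split=> //; rewrite -eq_uv //; [move=> ?; apply: far | move=> ?; apply: far' |]; lia.
have dv := tree_dist_edge tree_e' c.2 e_uv; have le1 := leq_b1 (u != v).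
have Bv := between_step tree_e' B' (step_edge e_uv) side'.
by split=> //; rewrite -eq_uv //; [move=> ?; apply: far | move=> ?; apply: far' |]; lia.
Qed.

(** Betweenness bounds the cop's moves by the two radii minus the remaining distances. These sum to
    at least 1, and to at least 2 if they are equal, which offsets the free vertex. *)
Lemma after_cop_bound n c u : eccentricity e z = rad e -> eccentricity e' z' = rad e' ->
  after_cop n c u -> c <> u -> n <= rad e + rad e' - 1.
Proof.
move=> ecc_z ecc_z' [B B' _ _ le_n] /pair_dist_gt0 pos.
have := dist_le_eccentricity e z u.1; have := dist_le_eccentricity e' z' u.2.
by move: B B'; rewrite /between ecc_z ecc_z'; lia.
Qed.

End Product.

(** * Counting visited vertices; the upper bound and the conclusion *)

Definition visited (T : eqType) (r : nat -> T) i := size (undup (mkseq r i)).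

Lemma visited_step (T : eqType) (r : nat -> T) i :
  visited r i.+2 <= visited r i.+1 + (r i != r i.+1).
Proof.
rewrite /visited (mkseqS r i.+1); set s := mkseq r i.+1.
have r_i_in : r i \in s by rewrite /s mkseqS mem_rcons mem_head.
have sub_u : {subset undup (rcons s (r i.+1)) <= r i.+1 :: undup s}.
  by move=> v; rewrite mem_undup mem_rcons !inE mem_undup.
have [eq_r|_] := eqVneq; last first.
  by rewrite addn1; exact: uniq_leq_size (undup_uniq _) sub_u.
rewrite addn0; apply: uniq_leq_size (undup_uniq _) _ => v /sub_u.
by rewrite inE => /predU1P[->|//]; rewrite -eq_r mem_undup.
Qed.

Lemma cop_can_limit_cartesian (T T' : finType) (e : rel T) (e' : rel T') :
  is_tree e -> is_tree e' ->
  cop_can_limit (cartesian e e') (rad e + rad e' - 1).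
Proof.
move=> tree_e tree_e'.
have [/card_gt0P[x _] /card_gt0P[x' _]] : 0 < #|T| /\ 0 < #|T'|.
  by case: tree_e; case: tree_e'.
have [z ecc_z] := center_exists e x; have [z' ecc_z'] := center_exists e' x'.
(* A strategy sees only the robber's history; folding recomputes the cop's position from it. *)
exists (foldl (chase e e') (z, z')) => [h v|r r_play].
  by rewrite foldl_rcons; apply: chase_step.
set c := cop_play _ r.
have cS i : c i.+1 = chase e e' (c i) (r i) by rewrite /c /cop_play mkseqS foldl_rcons.
have inv i : uncaptured c r i ->
    after_cop e e' z z' (visited r i.+1) (c i.+1) (r i).
  elim: i => [|i IHi] free; rewrite cS; apply: (after_chase tree_e tree_e').
    (* At the start the cop is at the center in both coordinates, and the [+ 1] pays for the
       robber's first vertex. *)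
    split; rewrite /c /cop_play //=; first exact: between_refl.
      exact: between_refl.
    by rewrite !dist_xx.
  have /IHi inv_i : uncaptured c r i by move=> j le_ji; apply/free/leqW.
  have [_ /(after_flight tree_e tree_e' inv_i)/(_ (r_play i))] := free i (leqnSn i).
  case=> B B' far far' le_n; split=> //.
  by apply: leq_trans le_n; exact: visited_step.
(* Damaged vertices come with separate rounds; the latest of these is still uncaptured, so the
   invariant there counts them all. *)
have covered (s : seq (T * T')) : {in s, forall v, damaged c r v} ->
    s = [::] \/ exists2 i, uncaptured c r i & {subset s <= mkseq r i.+1}.
  elim: s => [|v s IHs] dam_s; first by left.
  right; have [i [r_i free_i]] := dam_s v (mem_head _ _).
  have in_mkseq j k : j <= k -> r j \in mkseq r k.+1.
    by move=> le_jk; apply: map_f; rewrite mem_iota.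
  case: IHs => [w s_w|->|[j free_j sub_s]].
  - by apply: dam_s; rewrite inE s_w orbT.
  - by exists i => // w; rewrite inE => /eqP->; rewrite -r_i in_mkseq.
  exists (maxn i j).
    by rewrite /maxn; case: ifP.
  move=> w; rewrite inE => /predU1P[->|/sub_s/mapP[k]].
    by rewrite -r_i in_mkseq // leq_maxl.
  rewrite mem_iota add0n ltnS => /= le_kj ->.
  by rewrite in_mkseq // leq_max le_kj orbT.
rewrite /damage cardE.
case: (covered (enum [set v | `[< damaged c r v >]])) => [v|->|[i free_i sub_i]] //.
  by rewrite mem_enum inE => /asboolP.
have [_ neq_i] := free_i i (leqnn i).
apply: leq_trans (after_cop_bound tree_e tree_e' ecc_z ecc_z' (inv i free_i) neq_i).
by apply: uniq_leq_size => [|v /sub_i]; rewrite ?enum_uniq ?mem_undup.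
Qed.

Theorem theorem15 (T T' : finType) (e : rel T) (e' : rel T') :
  is_tree e -> is_tree e' ->
  dmg (cartesian e e') = rad (cartesian e e') - 1.
Proof.
move=> tree_e tree_e'.
have [/card_gt0P[x _] /card_gt0P[x' _]] : 0 < #|T| /\ 0 < #|T'|.
  by case: tree_e; case: tree_e'.
set E := cartesian e e'.
have conn : forall p q, connect E p q by exact: connect_cartesian.
have limit : cop_can_limit E (rad e + rad e' - 1) by exact: cop_can_limit_cartesian.
(* The bound of [rad E] from above comes from the game: the cop's limit meets the lower bound valid
   for every connected graph. *)
have rad_E : rad e + rad e' - 1 = rad E - 1.
  apply/eqP; rewrite eqn_leq (cop_can_limit_ge conn limit) andbT.
  by rewrite leq_sub2r // rad_cartesian_ge.
rewrite rad_E in limit.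
(* [least] needs a value strictly below the number of vertices; subtracting 1 from [rad E] gives it,
   as the product is nonempty. *)
have lt_card : rad E - 1 < #|{: T * T'}|.
  have card_gt0 : 0 < #|{: T * T'}| by apply/card_gt0P; exists (x, x').
  have := leq_trans (rad_le E (x, x')) (eccentricity_le_card E (x, x')).
  by case: (rad E) => [|m] le_card; rewrite subn1.
apply/eqP; rewrite eqn_leq least_le ?asboolT //=.
apply: (cop_can_limit_ge conn); apply/asboolP.
by apply: (least_holds (P := fun k => `[< cop_can_limit E k >]) lt_card); apply/asboolP.
Qed.
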